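(* Let $A=\sigma(\mathbb{F})\langle x_1,\dots,x_n\rangle$ be a quasi-commutative bijective skew $PBW$ extension of $\mathbb{F}$, where $\mathbb{F}$ is an algebraically closed field. Assume that the center $Z(A)$ is a polynomial ring in $n$ variables with coefficients in $\mathbb{F}$. Let $I$ be a two-sided ideal of $A$. Then $$\langle I_{Z(A)}(V_{Z(A)}(J))\rangle\subseteq\sqrt{I}\subseteq I(V(I)),$$ where $J:=l^{-1}(I)$, $l:Z(A)\to A$ is the inclusion of the center of $A$ in $A$, $V_{Z(A)}(J)$ is the vanishing set of $J$ with respect to $Z(A)$, $I_{Z(A)}(V_{Z(A)}(J))$ is the ideal of points of $V_{Z(A)}(J)$ with respect to $Z(A)$, and $\langle\,\cdot\,\rangle$ denotes the two-sided ideal of $A$ generated by a subset.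
   Context: Rings are associative with $1$, not necessarily commutative. Quasi-commutative skew $PBW$ extension: let $R\subseteq A$ be rings (here $R=\mathbb{F}$). $A=\sigma(R)\langle x_1,\dots,x_n\rangle$ is a quasi-commutative skew $PBW$ extension of $R$ if there are $x_1,\dots,x_n\in A$ such that: $A$ is a free left $R$-module with basis $\mathrm{Mon}(A)=\{x_1^{\alpha_1}\cdots x_n^{\alpha_n}\mid\alpha\in\mathbb{N}^n\}$ (with $0\in\mathbb{N}$); for every $1\le i\le n$ and $r\in R-\{0\}$ there is $c_{i,r}\in R-\{0\}$ with $x_ir=c_{i,r}x_i$; for all $1\le i,j\le n$ there is $c_{i,j}\in R-\{0\}$ with $x_jx_i=c_{i,j}x_ix_j$. Then for each $i$ there is an injective ring endomorphism $\sigma_i$ of $R$ with $x_ir=\sigma_i(r)x_i$ for all $r\in R$. $A$ is bijective if every $\sigma_i$ is bijective and every $c_{i,j}$ is invertible. Vanishing sets and ideals of points: for $Z=(z_1,\dots,z_n)\in\mathbb{F}^n$ let $\langle Z\rangle$ be the two-sided ideal of $A$ generated by $x_1-z_1,\dots,x_n-z_n$. For $f\in A$, write $f(Z)=0$ if and only if $f\in\langle Z\rangle$. For $S\subseteq A$, $V(S):=\{Z\in\mathbb{F}^n\mid f(Z)=0\text{ for every }f\in S\}$; for $X\subseteq\mathbb{F}^n$, $I(X):=\{g\in A\mid g(Z)=0\text{ for every }Z\in X\}$, a two-sided ideal of $A$. ''With respect to $Z(A)$'' means the same notions for the commutative polynomial ring $Z(A)=\mathbb{F}[t_1,\dots,t_n]$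 in its variables $t_1,\dots,t_n$: for $g\in Z(A)$ and $Z\in\mathbb{F}^n$, $g(Z)=0$ if and only if $g$ lies in the ideal of $Z(A)$ generated by $t_1-z_1,\dots,t_n-z_n$ (equivalently the usual evaluation of $g$ at $Z$ vanishes); $V_{Z(A)}(J)=\{Z\in\mathbb{F}^n\mid g(Z)=0\ \forall g\in J\}$ and $I_{Z(A)}(X)=\{g\in Z(A)\mid g(Z)=0\ \forall Z\in X\}$. Radical: a two-sided ideal $P\neq S$ of a ring $S$ is prime if for any left ideals $L,L'$ of $S$: $LL'\subseteq P$ if and only if $L\subseteq P$ or $L'\subseteq P$. For a two-sided ideal $I$ of $S$, $\sqrt{I}$ is the intersection of all prime ideals of $S$ containing $I$ (with $\sqrt{S}:=S$). *)

(* Defs.v *)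
From HB Require Import structures.
From mathcomp Require Export all_boot all_order all_algebra.
From mathcomp Require Export mpoly boolp classical_sets.

Set Implicit Arguments.
Unset Strict Implicit.
Unset Printing Implicit Defensive.

Import GRing.Theory.

Local Open Scope ring_scope.
Local Open Scope classical_set_scope.

(** * Ideals, primes and the radical in a (noncommutative) ring *)

Section Ideals.
Variable S : nzRingType.
Implicit Types I L P X : set S.

Definition left_ideal L : Prop :=
  [/\ L 0, (forall a b, L a -> L b -> L (a + b))
    & (forall r a, L a -> L (r * a))].

Definition two_sided_ideal I : Prop :=
  left_ideal I /\ (forall r a, I a -> I (a * r)).

Definition ideal_gen X : set S :=
  [set a | forall I, two_sided_ideal I -> X `<=` I -> I a].

Definition ideal_mul L L' : set S :=
  [set a | exists2 s : seq (S * S),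
     (forall p, p \in s -> L p.1 /\ L' p.2) & a = \sum_(p <- s) p.1 * p.2].

Definition prime_ideal P : Prop :=
  [/\ two_sided_ideal P, P <> setT
    & forall L L', left_ideal L -> left_ideal L' ->
        (ideal_mul L L' `<=` P <-> L `<=` P \/ L' `<=` P)].

(* When no prime contains [I], in particular when [I = setT], this is [setT]. *)
Definition radical I : set S :=
  [set a | forall P, prime_ideal P -> I `<=` P -> P a].

End Ideals.

(** * The center of a ring, as a commutative ring *)

Definition ring_center (A : nzRingType) : {pred A} :=
  fun z => `[< forall a, z * a = a * z >].
Arguments ring_center : clear implicits.

Lemma ring_centerP (A : nzRingType) (z : A) :
  reflect (forall a, z * a = a * z) (z \in ring_center A).
Proof. by rewrite unfold_in; apply: asboolP. Qed.

Lemma ring_center_subring (A : nzRingType) : subring_closed (ring_center A).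
Proof.
split.
- by apply/ring_centerP => a; rewrite mul1r mulr1.
- move=> y z /ring_centerP hy /ring_centerP hz; apply/ring_centerP => a.
  by rewrite mulrBl mulrBr hy hz.
- move=> y z /ring_centerP hy /ring_centerP hz; apply/ring_centerP => a.
  by rewrite -mulrA hz mulrA hy mulrA.
Qed.

HB.instance Definition _ (A : nzRingType) :=
  GRing.isSubringClosed.Build A (ring_center A) (ring_center_subring A).

Record centerType (A : nzRingType) : Type :=
  InCenter { center_val : A; _ : center_val \in ring_center A }.

HB.instance Definition _ (A : nzRingType) :=
  [isSub for @center_val A].
HB.instance Definition _ (A : nzRingType) := [Choice of centerType A by <:].
HB.instance Definition _ (A : nzRingType) :=
  [SubChoice_isSubNzRing of centerType A by <:].

Lemma center_mulC (A : nzRingType) : commutative (@GRing.mul (centerType A)).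
Proof. by move=> y z; apply/val_inj; apply: (ring_centerP _ (valP y)). Qed.

HB.instance Definition _ (A : nzRingType) :=
  GRing.PzRing_hasCommutativeMul.Build (centerType A) (@center_mulC A).

(** * Vanishing sets and ideals of points *)

Section Points.
Variables (F S : nzRingType) (n : nat).
Variables (iota : F -> S) (x : 'I_n -> S).

Definition point_ideal (Z : 'I_n -> F) : set S :=
  ideal_gen [set a | exists i, a = x i - iota (Z i)].

Definition vanishes_at (f : S) (Z : 'I_n -> F) : Prop := point_ideal Z f.

Definition vanishing_set (E : set S) : set ('I_n -> F) :=
  [set Z | forall f, E f -> vanishes_at f Z].

Definition ideal_of_points (X : set ('I_n -> F)) : set S :=
  [set g | forall Z, X Z -> vanishes_at g Z].

End Points.

(** * Polynomial rings and skew PBW extensions *)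

(* [mmap kappa t] is evaluation of polynomials at [t], with [kappa] applied to
   the coefficients; for [S] the center of a ring extension [A] of [F],
   [kappa] need not be the embedding of [F] in [A]. *)
Definition is_polynomial_ring (F S : comNzRingType) (n : nat)
    (kappa : {rmorphism F -> S}) (t : 'I_n -> S) : Prop :=
  bijective (mmap kappa t).

Section SkewPBW.
Variables (R A : nzRingType) (n : nat).
Variables (iota : {rmorphism R -> A}) (x : 'I_n -> A).

(* [{mpoly R[n]}] serves as the free left [R]-module on the exponents, and
   [mmap iota x] sends [p] to the sum of the [iota p@_m * x ^ m], with
   [x ^ m = x_0 ^ m_0 * ... * x_(n-1) ^ m_(n-1)] in this order. It is in general
   not multiplicative here. *)
Definition Mon_left_basis : Prop := bijective (mmap iota x).

Record quasi_comm_skew_PBW : Prop := QuasiCommSkewPBW {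
  qcPBW_inj : injective iota;
  qcPBW_basis : Mon_left_basis;
  qcPBW_coef : forall i (r : R), r != 0 ->
    exists2 c : R, c != 0 & x i * iota r = iota c * x i;
  qcPBW_var : forall i j,
    exists2 c : R, c != 0 & x j * x i = iota c * x i * x j
}.

End SkewPBW.

(* The [sigma] and the [c] below are unique, by freeness. *)
Definition bijective_skew_PBW (R : unitRingType) (A : nzRingType) (n : nat)
    (iota : {rmorphism R -> A}) (x : 'I_n -> A) : Prop :=
  (forall i, exists2 sigma : {rmorphism R -> R},
     bijective sigma & forall r, x i * iota r = iota (sigma r) * x i) /\
  (forall i j, exists2 c : R,
     c \is a GRing.unit & x j * x i = iota c * x i * x j).

(* Main.v *)
(** Modulo [<Z>] every element of [A] is congruent to a scalar, so [A/<Z>] is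
    either zero or [F]; a proper [<Z>] is thus prime, which gives the second
    inclusion.

    For the first one, let [P] be a prime of [A] containing [I]. Its trace on
    the center is completely prime and contains [J], so it is enough to show
    that for a prime [p] of [F[t_1, ..., t_n]] and [g] outside [p], some zero of
    [p] is not a zero of [g]. This strong form of the Nullstellensatz is proved
    by adding one variable at a time: an [F]-point of [R] which kills the trace
    of [P] on [R], but not a suitable element outside it, extends to an
    [F]-point of [R[X]] which kills [P] and not [g]. *)

From HB Require Import structures.
Require Import Defs.

Set Implicit Arguments.
Unset Strict Implicit.
Unset Printing Implicit Defensive.

Import GRing.Theory.

Local Open Scope ring_scope.
Local Open Scope classical_set_scope.

(** * Two-sided ideals and congruences *)

Section TwoSidedIdeals.
Variables (S : nzRingType) (I : set S).
Hypothesis hI : two_sided_ideal I.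

Lemma ideal0 : I 0. Proof. by case: hI => -[]. Qed.

Lemma idealD a b : I a -> I b -> I (a + b).
Proof. by case: hI => -[_ h _] _; apply: h. Qed.

Lemma idealMl r a : I a -> I (r * a).
Proof. by case: hI => -[_ _ h] _; apply: h. Qed.

Lemma idealMr r a : I a -> I (a * r).
Proof. by case: hI => _; apply. Qed.

Lemma idealN a : I a -> I (- a).
Proof. by rewrite -mulN1r; apply: idealMl. Qed.

Lemma idealB a b : I a -> I b -> I (a - b).
Proof. by move=> Ia /idealN; apply: idealD. Qed.

Lemma ideal_subl a b : I (a - b) -> I b -> I a.
Proof. by move=> Iab Ib; rewrite -(subrK b a); apply: idealD. Qed.

Lemma ideal_subr a b : I (a - b) -> I a -> I b.
Proof. by move=> Iab Ia; rewrite -(subKr a b); apply: idealB. Qed.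

Lemma ideal_sum (T : Type) (s : seq T) (Q : pred T) (f : T -> S) :
  (forall i, Q i -> I (f i)) -> I (\sum_(i <- s | Q i) f i).
Proof.
by move=> If; elim/big_ind: _ => //; [exact: ideal0 | exact: idealD].
Qed.

Lemma ideal_congM a b a' b' : I (a - b) -> I (a' - b') -> I (a * a' - b * b').
Proof.
move=> Iab Iab'.
have -> : a * a' - b * b' = (a - b) * a' + b * (a' - b').
  by rewrite mulrBl mulrBr addrA subrK.
by apply: idealD; [apply: idealMr | apply: idealMl].
Qed.

(** Monomials are compared factor by factor, in order, with coefficients on the left; this serves
    both [A] and its center. *)
Lemma ideal_cong_mmap (F : comNzRingType) (n : nat) (iota : {rmorphism F -> S})
    (x : 'I_n -> S) (z : 'I_n -> F) (q : {mpoly F[n]}) :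
  (forall i, I (x i - iota (z i))) -> I (mmap iota x q - iota q.@[z]).
Proof.
move=> Ix; rewrite mevalE rmorph_sum /= /mmap -sumrB.
apply: ideal_sum => m _; rewrite rmorphM -mulrBr; apply: idealMl.
rewrite /mmap1 rmorph_prod /=.
elim/big_ind2: _ => [||i _]; first by rewrite subrr; apply: ideal0.
  by move=> *; apply: ideal_congM.
rewrite rmorphXn /=; elim: (m i) => [|k IHk].
  by rewrite !expr0 subrr; apply: ideal0.
by rewrite !exprS; apply: ideal_congM.
Qed.

End TwoSidedIdeals.

Lemma two_sided_ideal_gen (S : nzRingType) (X : set S) :
  two_sided_ideal (ideal_gen X).
Proof.
split; [split|].
- by move=> I hI _; apply: ideal0.
- by move=> a b ha hb I hI XI; apply: idealD => //; [apply: ha | apply: hb].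
- by move=> r a ha I hI XI; apply: idealMl => //; apply: ha.
- by move=> r a ha I hI XI; apply: idealMr => //; apply: ha.
Qed.

Lemma two_sided_radical (S : nzRingType) (I : set S) :
  two_sided_ideal (radical I).
Proof.
split; [split|].
- by move=> P [hP _ _] _; apply: ideal0.
- move=> a b ha hb P PP IP; have [hP _ _] := PP.
  by apply: idealD => //; [apply: ha | apply: hb].
- by move=> r a ha P PP IP; have [hP _ _] := PP; apply: idealMl => //; apply: ha.
- by move=> r a ha P PP IP; have [hP _ _] := PP; apply: idealMr => //; apply: ha.
Qed.

(** * Completely prime ideals *)

Definition completely_prime (S : nzRingType) (P : set S) : Prop :=
  [/\ two_sided_ideal P, ~ P 1 & forall a b, P (a * b) -> P a \/ P b].

Lemma completely_primeX (S : nzRingType) (P : set S) a k :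
  completely_prime P -> P (a ^+ k) -> P a.
Proof.
move=> [_ P1 PM]; elim: k => [|k IHk]; first by rewrite expr0.
by rewrite exprS => /PM[].
Qed.

Lemma completely_prime_prime (S : nzRingType) (P : set S) :
  completely_prime P -> prime_ideal P.
Proof.
move=> [hP P1 PM]; split=> // [PT | L L' hL hL']; first by apply: P1; rewrite PT.
split=> [LL'P|].
  have [LP|/existsNP[a /not_implyP[La Pa]]] := pselect (L `<=` P); first by left.
  right=> b L'b; have [|//|//] := PM a b.
  apply: LL'P; exists [:: (a, b)]; last by rewrite big_seq1.
  by move=> p; rewrite inE => /eqP ->.
move=> LP a [s sLL' ->]; rewrite big_seq; apply: ideal_sum => // p /sLL'[Lp L'p].
by case: LP => LP; [apply: idealMr | apply: idealMl] => //; apply: LP.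
Qed.

(** Since [a] is central, [(r a)(r' b) = r r' (a b)]: the left ideals [A a] and [A b] have product
    inside [P] once [a b] is in [P]. *)
Lemma completely_prime_center (A : nzRingType) (P : set A) :
  prime_ideal P -> completely_prime (@center_val A @^-1` P).
Proof.
move=> [hP PT PM].
split=> [|P1|a b Pab].
- split; [split|]; rewrite /preimage /=.
  + exact: ideal0.
  + by move=> a b; apply: idealD.
  + by move=> r a; apply: idealMl.
  + by move=> r a; apply: idealMr.
- apply: PT; apply/seteqP; split=> // a _.
  by rewrite -(mulr1 a); apply: idealMl.
pose L (u : A) : set A := [set v | exists r, v = r * u].
have hL u : left_ideal (L u).
  split=> [|_ _ [r ->] [s ->]|r _ [s ->]]; first by exists 0; rewrite mul0r.
    by exists (r + s); rewrite mulrDl.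
  by exists (r * s); rewrite mulrA.
have LP u : L u `<=` P -> P u by apply; exists 1; rewrite mul1r.
have [PLL _] := PM _ _ (hL (val a)) (hL (val b)).
have [|/LP Pa|/LP Pb] := PLL; [|by left|by right].
move=> _ [s sL ->]; rewrite big_seq; apply: ideal_sum => // p /sL[[r ->] [r' ->]].
have /ring_centerP ca := valP a.
by rewrite -mulrA (mulrA (val a)) ca -mulrA; do 2!apply: idealMl => //.
Qed.

(** * Primes of [R[X]] and their trace on [R] *)

Section PrimeOfPoly.
Variables (R : comNzRingType) (P : set {poly R}).
Hypothesis hP : completely_prime P.

Let idP : two_sided_ideal P. Proof. by case: hP. Qed.

Let p : set R := [set a | P a%:P].

Lemma completely_prime_polyC : completely_prime p.
Proof.
case: hP => _ P1 PM; split=> [|//|a b]; last by rewrite /p /= polyCM => /PM.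
split; [split|]; rewrite /p /=.
- by rewrite polyC0; apply: ideal0.
- by move=> a b; rewrite polyCD; apply: idealD.
- by move=> r a; rewrite polyCM; apply: idealMl.
- by move=> r a; rewrite polyCM; apply: idealMr.
Qed.

Let idp : two_sided_ideal p. Proof. by case: completely_prime_polyC. Qed.

(** This is [p[X]]: working modulo [N] imitates [(R/p)[X]] without forming a quotient. *)
Let N : set {poly R} := [set f | forall i, p f`_i].

Lemma two_sided_coef : two_sided_ideal N.
Proof.
have NM r f : N f -> N (r * f).
  move=> Nf i; rewrite coefM; apply: ideal_sum => // j _.
  by apply: idealMl => //; apply: Nf.
split; [split|] => //.
- by move=> i; rewrite coef0; apply: ideal0.
- by move=> f g Nf Ng i; rewrite coefD; apply: idealD.
- by move=> r f Nf; rewrite mulrC; apply: NM.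
Qed.

Let idN := two_sided_coef.

Lemma coef_sub : N `<=` P.
Proof.
move=> f Nf; rewrite -[f]coefK poly_def; apply: ideal_sum => // i _.
by rewrite -mul_polyC; apply: idealMr => //; apply: Nf.
Qed.

(** Leading terms with coefficient in [p] are dropped; the size of [f'] then reflects the degree of
    [f] modulo [p]. *)
Lemma proper_trim (f : {poly R}) : ~ N f ->
  exists f', [/\ ~ p (lead_coef f'), N (f - f') & (size f' <= size f)%N].
Proof.
have [m] := ubnP (size f); elim: m f => // m IHm f; rewrite ltnS => lefm Nf.
have [pf|npf] := pselect (p (lead_coef f)); last first.
  by exists f; split=> //; rewrite subrr; apply: ideal0.
have f0 : f != 0 by apply/eqP => f0; apply: Nf; rewrite f0; apply: ideal0.
pose t := lead_coef f *: 'X^((size f).-1).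
have Nt : N t.
  move=> i; rewrite coefZ mulrC; exact: idealMl.
have ltft : (size (f - t)%R < size f)%N.
  rewrite [X in (_ < X)%N](polySpred f0) ltnS; apply/leq_sizeP => j.
  rewrite leq_eqVlt coefB coefZ coefXn => /predU1P[<-|ltj].
    by rewrite eqxx mulr1 subrr.
  rewrite gtn_eqF // mulr0 subr0 nth_default //.
  by rewrite (polySpred f0).
have [||f' [lf' Nff' lef']] := IHm (f - t).
- exact: leq_trans ltft lefm.
- by move=> /(ideal_subl idN)/(_ Nt).
exists f'; split=> //; last exact: leq_trans lef' (ltnW ltft).
by apply: (ideal_subl idN) Nt; rewrite addrAC.
Qed.

(** The pseudo-remainder of [f] by [h] lies in [Q] and is shorter than [h]; outside [N], its trimmed
    form would contradict the minimality of [h]. *)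
Lemma proper_minimal (Q : set {poly R}) : two_sided_ideal Q -> N `<=` Q ->
    ~ Q `<=` N ->
  exists h, [/\ Q h, ~ p (lead_coef h),
    forall f, Q f -> ~ p (lead_coef f) -> (size h <= size f)%N &
    forall f, Q f -> exists k q, N (lead_coef h ^+ k *: f - q * h)].
Proof.
move=> idQ NQ /existsNP[f0 /not_implyP[Qf0 Nf0]].
pose D d := `[< exists f, [/\ Q f, ~ p (lead_coef f) & size f = d] >].
have trimQ f : Q f -> ~ N f ->
    exists f', [/\ Q f', ~ p (lead_coef f') & (size f' <= size f)%N].
  move=> Qf /proper_trim[f' [lf' Nff' lef']]; exists f'; split=> //.
  by apply: (ideal_subr idQ) Qf; apply: NQ.
have exD : exists d, D d.
  have [f' [Qf' lf' _]] := trimQ _ Qf0 Nf0.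
  by exists (size f'); apply/asboolP; exists f'.
have [d /asboolP[h [Qh lh sh]] dmin] := ex_minnP exD.
have hmin f : Q f -> ~ p (lead_coef f) -> (size h <= size f)%N.
  by move=> Qf lf; rewrite sh; apply: dmin; apply/asboolP; exists f.
exists h; split=> // f Qf.
have h0 : h != 0.
  by apply/eqP => h0; apply: lh; rewrite h0 lead_coef0; apply: ideal0.
have fE := Pdiv.ComRing.rdivp_eq h f.
exists (Pdiv.Ring.rscalp f h), (Pdiv.Ring.rdivp f h).
rewrite fE addrAC subrr add0r; set r := Pdiv.Ring.rmodp f h.
apply: contrapT => /trimQ[|f' [Qf' lf' lef']].
  have -> : r = lead_coef h ^+ Pdiv.Ring.rscalp f h *: f
                - Pdiv.Ring.rdivp f h * h.
    by rewrite fE addrAC subrr add0r.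
  by apply: idealB => //; rewrite -?mul_polyC; apply: idealMl.
have := leq_ltn_trans lef' (Pdiv.Ring.ltn_rmodpN0 f h0).
by rewrite ltnNge hmin.
Qed.

(* The ideal [P + (g)] meets [R] outside [p]: its element of least degree [h1]
   modulo [p] divides both [g] and a least-degree element [h0] of [P], up to a
   constant. It is not in [P] because [g] is not, so the cofactor of [h0] is,
   and minimality of [h0] forces [h1] to be constant. *)
Lemma prime_add_const (g : {poly R}) : ~ P g -> ~ P `<=` N ->
  exists c u, ~ p c /\ P (c%:P - u * g).
Proof.
move=> Pg PN; have [_ _ PM] := hP; have [_ _ pM] := completely_prime_polyC.
have [h0 [Ph0 lh0 min0 _]] := proper_minimal idP coef_sub PN.
pose Q : set {poly R} := [set f | exists u, P (f - u * g)].
have PQ : P `<=` Q by move=> f Pf; exists 0; rewrite mul0r subr0.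
have idQ : two_sided_ideal Q.
  have QM r f : Q f -> Q (r * f).
    by move=> [u Pu]; exists (r * u); rewrite -mulrA -mulrBr; apply: idealMl.
  split; [split|] => //; first by apply: PQ; apply: ideal0.
  - move=> f f' [u Pu] [u' Pu']; exists (u + u').
    by rewrite mulrDl opprD addrACA; apply: idealD.
  - by move=> r f; rewrite mulrC; apply: QM.
have [h1 [[u Pu] lh1 _ div1]] :=
  proper_minimal idQ (subset_trans coef_sub PQ) (fun QN => PN (subset_trans PQ QN)).
have Ph1 : ~ P h1.
  move=> Ph1; have [|k [q /coef_sub Nq]] := div1 g.
    by exists 1; rewrite mul1r subrr; apply: ideal0.
  have := ideal_subl idP Nq (idealMl idP q Ph1).
  rewrite -mul_polyC => /PM[|//].
  by rewrite -/(p _) => /(completely_primeX completely_prime_polyC).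
have [k [q Nq]] := div1 _ (PQ _ Ph0).
have Pq : P q.
  have := ideal_subr idP (coef_sub Nq).
  by rewrite -mul_polyC => /(_ (idealMl idP _ Ph0)) /PM[].
have nNq : ~ N q.
  (* This index reads the leading coefficient of [h0], so that [lead_coef h1 ^+ k * lead_coef h0]
     would lie in [p]. *)
  move=> qN; have := ideal_subl idN Nq (idealMr idN h1 qN) (size h0).-1.
  rewrite coefZ => /pM[/(completely_primeX completely_prime_polyC)|] //.
have [q' [lq' Nqq' _]] := proper_trim nNq.
have Pq' : P q' by apply: (ideal_subr idP) Pq; apply: coef_sub.
have Nq' : N (lead_coef h1 ^+ k *: h0 - q' * h1).
  have -> : lead_coef h1 ^+ k *: h0 - q' * h1 =
     (lead_coef h1 ^+ k *: h0 - q * h1) + (q - q') * h1.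
    by rewrite mulrBl addrA subrK.
  by apply: (idealD idN) Nq _; apply: (idealMr idN).
have sh1 : (size h1 <= 1)%N.
  rewrite leqNgt; apply/negP => lt1.
  (* At this index [q' * h1] has the product of the leading coefficients, whereas [h0] has 0: for
     [size h1 > 1] the index is at least [size q'], hence at least [size h0]. *)
  have := Nq' (size q' + size h1).-2.
  rewrite coefB -mul_lead_coef coefZ nth_default ?mulr0 ?sub0r; last first.
    apply: leq_trans (min0 _ Pq' lq') _.
    by case: (size h1) lt1 => [|[|s]] // _; rewrite !addnS /= leq_addr.
  by move=> /(idealN idp); rewrite opprK => /pM[].
exists (lead_coef h1), u; split=> //.
by rewrite (size1_polyC sh1) lead_coefC -size1_polyC.
Qed.

End PrimeOfPoly.

(** * The strong Nullstellensatz *)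

Section Nullstellensatz.
Variable F : closedFieldType.

(** At a root of [q - 1] the value of [q] is 1; a constant [q] is treated apart. *)
Lemma closed_nonroot (q : {poly F}) : q != 0 -> exists z, q.[z] != 0.
Proof.
move=> q0; have [s1|s1] := boolP (size q == 1%N).
  by exists 0; move: s1 => /size_poly1P[c c0 ->]; rewrite hornerC.
have /closed_rootP[z] : size (q - 1) != 1%N.
  have lt1 : (1 < size q)%N.
    by rewrite ltn_neqAle eq_sym s1 lt0n size_poly_eq0.
  rewrite size_polyDl; first by rewrite neq_ltn lt1 orbT.
  by rewrite size_polyN size_poly1.
rewrite /root !hornerE subr_eq0 => /eqP qz.
by exists z; rewrite qz oner_neq0.
Qed.

(** Sparing [g] is what the induction runs on: in the step it keeps a leading coefficient nonzero at
    the point of [R]. *)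
Definition points_separate_primes (R : comNzRingType) (k : {rmorphism F -> R}) :=
  forall P : set R, completely_prime P -> forall g, ~ P g ->
  exists phi : {rmorphism R -> F},
    [/\ forall c, phi (k c) = c, forall a, P a -> phi a = 0 & phi g != 0].

Lemma separate_base : points_separate_primes (idfun : {rmorphism F -> F}).
Proof.
move=> P [hP P1 _] g Pg; exists idfun; split=> // [a Pa|]; last first.
  by apply/eqP => /= g0; apply: Pg; rewrite g0; apply: ideal0.
apply/eqP/negP => a0; apply: P1.
by rewrite -(mulVf (introN idP a0)); apply: idealMl.
Qed.

Lemma separate_poly (R : comNzRingType) (k : {rmorphism F -> R}) :
  points_separate_primes k ->
  points_separate_primes (polyC \o k : {rmorphism F -> {poly R}}).
Proof.
move=> sepR P hP g Pg.
have hp := completely_prime_polyC hP; have [idP P1 PM] := hP; have [_ _ pM] := hp.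
pose ev (phi : {rmorphism R -> F}) z : {rmorphism {poly R} -> F} :=
  horner_eval z \o map_poly phi.
have evE phi z f : ev phi z f = (map_poly phi f).[z] by [].
have evC phi z c : ev phi z c%:P = phi c by rewrite evE map_polyC hornerC.
have evN (phi : {rmorphism R -> F}) z (f : {poly R}) : (forall a, P a%:P -> phi a = 0) ->
    (forall i, P (f`_i)%:P) -> ev phi z f = 0.
  move=> phi0 Nf; rewrite evE; suff -> : map_poly phi f = 0 by rewrite horner0.
  by apply/polyP => i; rewrite coef_map coef0; apply: phi0; apply: Nf.
(* In the first case [P] is extended from [R]: a point sparing one coefficient of [g] leaves a
   nonzero polynomial in one variable, and [z] is a nonroot of it. *)
have [PN|PN] := pselect (P `<=` [set f | forall i, P (f`_i)%:P]).
  have /existsNP[i Pgi] : ~ forall i, P (g`_i)%:P.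
    by move=> /(coef_sub hP).
  have [phi [phik phi0 phig]] := sepR _ hp _ Pgi.
  have [|z gz] := closed_nonroot (q := map_poly phi g).
    by apply: contra phig => /eqP/polyP/(_ i); rewrite coef_map coef0 => /eqP.
  exists (ev phi z); split=> // [c|f Pf]; first exact: etrans (evC _ _ _) (phik c).
  by apply: evN => //; apply: PN.
have [h [Ph lh _ divh]] := proper_minimal hP idP (coef_sub hP) PN.
have [c [u [pc Pcu]]] := prime_add_const hP Pg PN.
(* With [lead_coef h] spared, [h] keeps its degree and gets a root [z]; with [c] spared, [g] cannot
   vanish, being a factor of [c] modulo [P]. *)
have [|phi [phik phi0]] := sepR _ hp (lead_coef h * c).
  by move=> /pM[].
rewrite rmorphM mulf_eq0 negb_or => /andP[phih phic].
have /closed_rootP[z hz] : size (map_poly phi h) != 1%N.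
  rewrite size_map_poly_id0 //; apply/eqP => s1; apply: lh.
  by move: Ph; rewrite [h]size1_polyC ?s1 // lead_coefC.
(* At [z] the pseudo-division of [f] by [h] leaves a nonzero power of [phi (lead_coef h)] times the
   value of [f]. *)
have evP f : P f -> ev phi z f = 0.
  move=> /divh[m [q /(evN _ z _ phi0)/eqP]].
  rewrite rmorphB rmorphM -mul_polyC rmorphM evC rmorphXn [X in _ - _ * X]evE.
  rewrite (rootP hz) mulr0 subr0 mulf_eq0 expf_eq0 (negbTE phih) andbF.
  by move=> /eqP.
exists (ev phi z); split=> // [c'|]; first exact: etrans (evC _ _ _) (phik c').
apply: contra phic => /eqP g0.
by have /eqP := evP _ Pcu; rewrite rmorphB rmorphM g0 mulr0 subr0 evC.
Qed.

(** A point of [R] that kills the preimage of [P] kills the kernel of [psi], hence factors through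
    [S]. *)
Lemma separate_surj (R S : comNzRingType) (k : {rmorphism F -> R})
    (k' : {rmorphism F -> S}) (psi : {rmorphism R -> S}) :
  (forall s, exists r, psi r = s) -> (forall c, psi (k c) = k' c) ->
  points_separate_primes k -> points_separate_primes k'.
Proof.
move=> /choice[r rK] psik sepR P [hP P1 PM] g Pg.
have [||phi [phik phi0 phig]] := sepR (psi @^-1` P) _ (r g).
- split=> [||a b]; last by rewrite /preimage /= rmorphM => /PM.
  + split; [split|]; rewrite /preimage /=.
    * by rewrite rmorph0; apply: ideal0.
    * by move=> a b; rewrite rmorphD; apply: idealD.
    * by move=> s a; rewrite rmorphM; apply: idealMl.
    * by move=> s a; rewrite rmorphM; apply: idealMr.
  + by rewrite /preimage /= rmorph1.
- by rewrite /preimage /= rK.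
have phi_eq a b : psi a = psi b -> phi a = phi b.
  move=> /eqP; rewrite -subr_eq0 -rmorphB => /eqP ab0.
  apply/eqP; rewrite -subr_eq0 -rmorphB; apply/eqP/phi0.
  by rewrite /preimage /= ab0; apply: ideal0.
(* [r] only chooses preimages, but [phi] is constant on the fibres of [psi], so [phi \o r] is a
   morphism. *)
have addf : zmod_morphism (phi \o r).
  by move=> a b; rewrite /= -rmorphB; apply: phi_eq; rewrite rmorphB !rK.
have mulf : monoid_morphism (phi \o r).
  split=> [|a b]; rewrite /=.
    by rewrite -(rmorph1 phi); apply: phi_eq; rewrite rK rmorph1.
  by rewrite -rmorphM; apply: phi_eq; rewrite rmorphM !rK.
pose f : {rmorphism S -> F} := HB.pack (phi \o r)
  (GRing.isZmodMorphism.Build _ _ _ addf) (GRing.isMonoidMorphism.Build _ _ _ mulf).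
exists f; split=> //= [c|a Pa].
  by rewrite -[RHS]phik; apply: phi_eq; rewrite rK psik.
by apply: phi0; rewrite /preimage /= rK.
Qed.

(** With one more generator, [S] is a quotient of [{poly {mpoly F[n]}}]; the induction hypothesis is
    applied to [{mpoly F[n]}]. *)
Lemma separate_fin_gen (n : nat) (S : comNzRingType) (k : {rmorphism F -> S})
    (t : 'I_n -> S) :
  (forall s, exists q, mmap k t q = s) -> points_separate_primes k.
Proof.
elim: n S k t => [|n IHn] S k t surj.
  apply: (separate_surj (psi := k)) separate_base => // s.
  have [q <-] := surj s; exists q@_0.
  by rewrite [in RHS](nvar0_mpolyC q) mmapC.
have /separate_poly : points_separate_primes (mpolyC n (R := F)).
  apply: (IHn _ _ (fun i => 'X_i)) => q; exists q.
  rewrite [RHS]mpolyE; apply: eq_bigr => m _.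
  by rewrite mul_mpolyC mmap1_id.
pose t0 (i : 'I_n) := t (lift ord_max i).
pose psi : {rmorphism {poly {mpoly F[n]}} -> S} :=
  horner_eval (t ord_max) \o map_poly (mmap k t0).
apply: (separate_surj (psi := psi)) => [s|c]; last first.
  by rewrite /psi /= /horner_eval map_polyC hornerC /= mmapC.
have [q <-] := surj s.
pose t1 i : {poly {mpoly F[n]}} :=
  if unlift ord_max i is Some j then ('X_j)%:P else 'X.
exists (mmap (polyC \o mpolyC n (R := F)) t1 q).
rewrite [in LHS]/mmap rmorph_sum; apply: eq_bigr => m _.
rewrite rmorphM rmorph_prod; congr (_ * _).
  by rewrite /psi /= /horner_eval map_polyC hornerC /= mmapC.
apply: eq_bigr => i _; rewrite rmorphXn; congr (_ ^+ _).
rewrite /psi /t1 /= /horner_eval; case: unliftP => [j ->|->].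
  by rewrite map_polyC hornerC /= mmapX mmap1U.
by rewrite map_polyX hornerX.
Qed.

End Nullstellensatz.

Theorem theorem4p16 (F : closedFieldType) (A : nzRingType) (n : nat)
    (iota : {rmorphism F -> A}) (x : 'I_n -> A)
    (hA : quasi_comm_skew_PBW iota x) (hbij : bijective_skew_PBW iota x)
    (kappa : {rmorphism F -> centerType A}) (t : 'I_n -> centerType A)
    (hZ : is_polynomial_ring kappa t)
    (I : set A) (hI : two_sided_ideal I) :
  let l : centerType A -> A := @center_val A in
  let J : set (centerType A) := l @^-1` I in
  ideal_gen (l @` ideal_of_points kappa t (vanishing_set kappa t J))
    `<=` radical I
  /\ radical I `<=` ideal_of_points iota x (vanishing_set iota x I).
Proof.
move=> l J.
have gen_pt (S : nzRingType) (k : {rmorphism F -> S}) (y : 'I_n -> S) Z i :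
    point_ideal k y Z (y i - k (Z i)).
  by move=> K _; apply; exists i.
split.
  move=> a; apply; first exact: two_sided_radical.
  move=> _ [g gv <-] P primeP IP; apply: contrapT => Pg.
  have surj s : exists q, mmap kappa t q = s.
    by have [r _ rK] := hZ; exists (r s).
  have [phi [phik phi0 /eqP]] :=
    separate_fin_gen surj (completely_prime_center primeP) Pg.
  (* [phi] is evaluation at this [Z]: the next claims identify its kernel with the ideal of [Z]. *)
  apply; pose Z i := phi (t i).
  have ker_ideal : two_sided_ideal [set f | phi f = 0].
    split; [split|] => [|a' b a0 b0|r b b0|r b b0]; rewrite /=.
    - exact: rmorph0.
    - by rewrite rmorphD a0 b0 addr0.
    - by rewrite rmorphM b0 mulr0.
    - by rewrite rmorphM b0 mul0r.
  have ptphi f : vanishes_at kappa t f Z -> phi f = 0.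
    by move=> /(_ _ ker_ideal); apply=> _ [i ->]; rewrite /= rmorphB phik subrr.
  have phipt f : phi f = 0 -> vanishes_at kappa t f Z.
    have [q <-] := surj f => f0.
    have cong := ideal_cong_mmap (two_sided_ideal_gen _) q (gen_pt _ kappa t Z).
    have := ptphi _ cong; rewrite rmorphB f0 phik sub0r => /eqP.
    by rewrite oppr_eq0 => /eqP q0; move: cong; rewrite q0 rmorph0 subr0.
  (* As [J] lies in the trace of [P], [phi] kills it, so [Z] is a zero of [J] and hence of [g]. *)
  apply: ptphi; apply: gv => f Jf; apply: phipt; apply: phi0.
  exact: IP.
move=> a rada Z VZ.
have hZI : two_sided_ideal (point_ideal iota x Z) by exact: two_sided_ideal_gen.
have [Z1|Z1] := pselect (point_ideal iota x Z 1).
  by rewrite /vanishes_at -(mulr1 a); apply: (idealMl hZI).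
(* [VZ] puts [I] inside the ideal of [Z]; complete primeness of that ideal suffices. *)
apply: rada VZ; apply: completely_prime_prime; split=> // b c.
have congF d : exists r, point_ideal iota x Z (d - iota r).
  have [mon _ monK] := qcPBW_basis hA; rewrite -(monK d).
  by exists (mon d).@[Z]; apply: ideal_cong_mmap.
have [r br] := congF b; have [s cs] := congF c.
(* A nonzero scalar [r * s] in the ideal would be invertible and bring 1 into it. *)
move=> /(ideal_subr hZI (ideal_congM hZI br cs)); rewrite -rmorphM => Irs.
have [r0|r0] := eqVneq r 0; first by left; move: br; rewrite r0 rmorph0 subr0.
have [s0|s0] := eqVneq s 0; first by right; move: cs; rewrite s0 rmorph0 subr0.
case: Z1; rewrite -(rmorph1 iota) -(mulVf (mulf_neq0 r0 s0)) rmorphM.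
exact: (idealMl hZI).
Qed.
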